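(* Let $G$ be a connected bipartite graph with color classes $E$ and $V$, let $d=|E|+|V|-2$, and let $\varepsilon_G(s)=|(s\cdot Q_G)\cap(\mathbf Z^E\oplus\mathbf Z^V)|$ be the Ehrhart polynomial of its root polytope, written (uniquely) as $\varepsilon_G(s)=\sum_{k=0}^{d}a_k\binom{s+d-k}{d}$ with rational $a_k$. Then the $h$-vector $h$ of any triangulation of $Q_G$ satisfies \[x^{|E|+|V|-1}h(x^{-1})=a_0+a_1x+\cdots+a_dx^d.\] In particular, all triangulations of $Q_G$ have the same $h$-vector.
   Context: Bipartite graphs have no multiple edges; every edge joins $E$ to $V$. The root polytope $Q_G\subset\mathbf R^E\oplus\mathbf R^V$ is the convex hull of $\mathbf i_{\{e\}}+\mathbf i_{\{v\}}$ over edges $ev$ of $G$ ($\mathbf i$ = indicator vector); it has dimension $d=|E|+|V|-2$ when $G$ is connected. $\binom{s+d-k}{d}$ is regarded as a polynomial in $s$. A triangulation of $Q_G$ is a collection of $d$-dimensional simplices spanned by vertices of $Q_G$, pairwise intersecting in common faces, with union $Q_G$, viewed as the simplicial complex of all their faces. Its $f$-vector is $f(y)=y^{d+1}+f_0y^d+\cdots+f_{d-1}y+f_d$ with $f_k$ the number of $k$-dimensional simplices, and its $h$-vector is $h(x)=f(x-1)$. *)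

(* Defs.v *)
From HB Require Import structures.
From mathcomp Require Import all_boot all_order all_algebra.
From mathcomp Require Import reals.
Set Implicit Arguments. Unset Strict Implicit. Unset Printing Implicit Defensive.
Import Order.TTheory GRing.Theory Num.Theory.
Local Open Scope ring_scope.

Section RootPolytope.
Variables (R : realType) (E V : finType).

(* A bipartite graph with colour classes E and V, given by its edge set
   G : {set E * V} (no multiple edges). *)

Definition bip_adj (G : {set E * V}) : rel (E + V) :=
  fun x y => match x, y with
             | inl e, inr v => (e, v) \in G
             | inr v, inl e => (e, v) \in G
             | _, _ => false
             end.

Definition bip_connected (G : {set E * V}) : Prop :=
  forall x y : E + V, connect (bip_adj G) x y.

(* the point  i_{e} + i_{v}  of R^E (+) R^V (coordinates indexed by E + V) *)
Definition edge_pt (ev : E * V) (z : E + V) : R :=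
  ((z == inl ev.1) || (z == inr ev.2))%:R.

Definition in_conv (S : {set E * V}) (x : E + V -> R) : Prop :=
  exists lam : E * V -> R,
    [/\ forall i, 0 <= lam i,
        forall i, i \notin S -> lam i = 0,
        \sum_(i in S) lam i = 1
      & forall z, x z = \sum_(i in S) lam i * edge_pt i z].

Definition root_polytope (G : {set E * V}) (x : E + V -> R) : Prop :=
  in_conv G x.

Definition dilate (s : nat) (Q : (E + V -> R) -> Prop) (x : E + V -> R) : Prop :=
  exists y, Q y /\ forall z, x z = s%:R * y z.

Definition lattice_count (G : {set E * V}) (s n : nat) : Prop :=
  exists l : seq {ffun E + V -> int},
    [/\ uniq l,
        forall x : {ffun E + V -> int},
          x \in l <-> dilate s (root_polytope G) (fun z => (x z)%:~R)
      & size l = n].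

Definition aff_indep (S : {set E * V}) : Prop :=
  forall c : E * V -> R,
    \sum_(i in S) c i = 0 ->
    (forall z, \sum_(i in S) c i * edge_pt i z = 0) ->
    forall i, i \in S -> c i = 0.

Definition rp_dim : nat := (#|E| + #|V| - 2)%N.

(* A triangulation of Q_G: a collection of d-dimensional simplices spanned by
   vertices of Q_G (each simplex given by its vertex set, a set of d+1 edges
   whose points are affinely independent), pairwise intersecting in a common
   face, with union Q_G. *)
Definition triangulation (G : {set E * V}) (T : {set {set E * V}}) : Prop :=
  [/\ forall S, S \in T -> [/\ S \subset G, #|S| = rp_dim.+1 & aff_indep S],
      forall S1 S2, S1 \in T -> S2 \in T ->
        exists2 F : {set E * V}, (F \subset S1) && (F \subset S2) &
          forall x, (in_conv S1 x /\ in_conv S2 x) <-> in_conv F x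
    & forall x, root_polytope G x -> exists2 S, S \in T & in_conv S x].

Definition fnum (T : {set {set E * V}}) (k : nat) : nat :=
  #|[set F : {set E * V} | (#|F| == k.+1) && [exists S in T, F \subset S]]|.

Definition fpoly (T : {set {set E * V}}) : {poly rat} :=
  'X^(rp_dim.+1) + \sum_(k < rp_dim.+1) (fnum T k)%:R *: 'X^(rp_dim - k).

Definition hpoly (T : {set {set E * V}}) : {poly rat} :=
  fpoly T \Po ('X - 1).

End RootPolytope.

(* Main.v *)
(* The vectors of an affinely independent set of edges are a unimodular system,
   so every lattice point of s * Q_G lying over a simplex of a triangulation has
   nonnegative integer coordinates there. Since simplices meet along faces, the
   lattice points of s * Q_G correspond bijectively to the maps m : E * V -> nat
   of total sum s whose support is a face, the empty face accounting for s = 0.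
   Counting these by support gives the Ehrhart series
     sum_F (t / (1 - t))^|F| = (1 - t)^-(d+1) t^(d+1) h(1 / t),
   the sum being over all faces F, while binom(s + d - k, d) has series
   t^k / (1 - t)^(d+1). The power series are truncated: all identities hold modulo
   t^(N+1), and N = d + 1 exceeds the relevant degrees. *)
Require Import Defs.
From HB Require Import structures.
From mathcomp Require Import all_boot all_order all_algebra.
From mathcomp Require Import reals.
From mathcomp Require Import ring.
Set Implicit Arguments. Unset Strict Implicit. Unset Printing Implicit Defensive.
Import Order.TTheory GRing.Theory Num.Theory.
Local Open Scope ring_scope.

(** * Unimodularity of affinely independent sets of edge vectors *)

Lemma exists_linear_relation (F : fieldType) (I J : finType) (M : I -> J -> F)
    (A : {set I}) (B : {set J}) :
  (#|B| < #|A|)%N ->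
  exists c : I -> F, (exists2 i, i \in A & c i != 0) /\
    (forall j, j \in B -> \sum_(i in A) c i * M i j = 0).
Proof.
move=> ltBA.
pose Mx := \matrix_(i < #|A|, j < #|B|) M (enum_val i) (enum_val j).
have ker_neq0 : kermx Mx != 0.
  rewrite -mxrank_eq0 mxrank_ker -lt0n subn_gt0.
  exact: leq_ltn_trans (rank_leq_col _) ltBA.
have [u /sub_kermxP uM u_neq0] := rowV0Pn ker_neq0.
have [i0 u0i0] : exists i, u 0 i != 0.
  apply/existsP; apply: contraR u_neq0 => /existsPn u0.
  by apply/eqP/rowP => i; rewrite mxE; apply/eqP; rewrite -[_ == _]negbK u0.
have Ai0 : enum_val i0 \in A by apply: enum_valP.
exists (fun i => u 0 (enum_rank_in Ai0 i)); split.
  by exists (enum_val i0); rewrite ?enum_valK_in.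
move=> j Bj; have /rowP/(_ (enum_rank_in Bj j)) := uM; rewrite !mxE => uMj.
rewrite -[RHS]uMj big_enum_val; apply: eq_bigr => i _.
by rewrite enum_valK_in !mxE enum_rankK_in.
Qed.

Section EdgeVectors.
Variables (R : realType) (E V : finType).
Implicit Types (S : {set E * V}) (c : E * V -> R) (i : E * V) (z : E + V).

Lemma edge_pt_inl i e : edge_pt R i (inl e) = (e == i.1)%:R.
Proof. by rewrite /edge_pt orbF. Qed.

Lemma edge_pt_inr i v : edge_pt R i (inr v) = (v == i.2)%:R.
Proof. by []. Qed.

(** Each edge has exactly one end in [E], so the total weight of a combination can be read off from
    its [E]-coordinates. *)
Lemma sum_edge_pt_inl S c :
  \sum_e \sum_(i in S) c i * edge_pt R i (inl e) = \sum_(i in S) c i.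
Proof.
rewrite exchange_big; apply: eq_bigr => i _ /=.
rewrite (bigD1 i.1) //= edge_pt_inl eqxx mulr1 big1 ?addr0 // => e /negPf ne.
by rewrite edge_pt_inl ne mulr0.
Qed.

Lemma sum_edge_pt_inr S c :
  \sum_v \sum_(i in S) c i * edge_pt R i (inr v) = \sum_(i in S) c i.
Proof.
rewrite exchange_big; apply: eq_bigr => i _ /=.
rewrite (bigD1 i.2) //= edge_pt_inr eqxx mulr1 big1 ?addr0 // => v /negPf nv.
by rewrite edge_pt_inr nv mulr0.
Qed.

(** The coefficients of the difference sum to 0, being the sum of its vanishing [E]-coordinates;
    thus affine independence acts as linear independence. *)
Lemma aff_indep_coord_inj S c c' : aff_indep R S ->
  (forall z, \sum_(i in S) c i * edge_pt R i z =
             \sum_(i in S) c' i * edge_pt R i z) ->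
  {in S, c =1 c'}.
Proof.
move=> indS eqcc' i Si; apply/eqP; rewrite -subr_eq0; apply/eqP.
apply: (indS (fun i => c i - c' i)) => // [|z].
  rewrite sumrB -!sum_edge_pt_inl; apply/eqP; rewrite subr_eq0; apply/eqP.
  by apply: eq_bigr.
under eq_bigr do rewrite mulrBl.
by rewrite sumrB eqcc' subrr.
Qed.

Lemma edge_pt_neq0_card i : #|[set z | edge_pt R i z != 0]| = 2%N.
Proof.
rewrite (_ : [set z | _] = [set inl i.1; inr i.2]); first by rewrite cards2.
by apply/setP=> z; rewrite !inE pnatr_eq0 eqb0 negbK.
Qed.

Lemma aff_indep_sub S S' : S' \subset S -> aff_indep R S -> aff_indep R S'.
Proof.
move=> sS'S indS c c0 cz i S'i.
pose c' i := if i \in S' then c i else 0.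
have sum_c' (g : E * V -> R) : \sum_(i in S) c' i * g i = \sum_(i in S') c i * g i.
  rewrite (big_setID S') /= (setIidPr sS'S) [X in _ + X]big1 ?addr0.
    by apply: eq_bigr => j S'j; rewrite /c' S'j.
  by move=> j /setDP[_ /negPf nS'j]; rewrite /c' nS'j mul0r.
have := indS c' _ _ i (subsetP sS'S i S'i); rewrite {3}/c' S'i; apply.
  have := sum_c' (fun=> 1).
  under eq_bigr do rewrite mulr1.
  by under [RHS]eq_bigr do rewrite mulr1; rewrite c0.
by move=> z; rewrite sum_c'.
Qed.

(* Without a leaf, counting incidences gives #|W| <= #|S| for the set W of
   covered vertices; an affine relation then comes from dropping one of the
   #|W| coordinate equations, which is implied by the others because the E- and
   V-coordinates have equal sums. *)
Lemma aff_indep_leaf S : aff_indep R S -> S != set0 ->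
  exists z i, [/\ i \in S, edge_pt R i z != 0 &
                 forall j, j \in S -> j != i -> edge_pt R j z = 0].
Proof.
move=> indS /set0Pn[i0 Si0].
pose D z := [set i in S | edge_pt R i z != 0].
pose W := [set z | D z != set0].
have [/existsP[z /cards1P[i Dz]]|/existsPn noleaf] := boolP [exists z, #|D z| == 1%N].
  have : i \in D z by rewrite Dz set11.
  rewrite inE => /andP[Si iz]; exists z, i; split=> // j Sj ne_ji.
  apply: contraNeq ne_ji => jz.
  have : j \in D z by rewrite inE Sj.
  by rewrite Dz inE.
have Wi0 : inl i0.1 \in W.
  rewrite inE; apply/set0Pn; exists i0.
  by rewrite inE Si0 edge_pt_inl eqxx oner_neq0.
have leWS : (#|W| <= #|S|)%N.
  rewrite -(leq_pmul2r (isT : (0 < 2)%N)) -!sum_nat_const.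
  rewrite (eq_bigr (fun i => \sum_z (edge_pt R i z != 0%R))%N); last first.
    by move=> i _; rewrite -(edge_pt_neq0_card i) -sum1dep_card big_mkcond.
  rewrite exchange_big /= [leqRHS](bigID (mem W)) /=.
  apply: leq_trans (leq_addr _ _); apply: leq_sum => z; rewrite inE => Dz0.
  have := noleaf z; rewrite -cards_eq0 in Dz0.
  rewrite (_ : (\sum_(i in S) _)%N = #|D z|); first by case: #|D z| Dz0 => [|[]].
  by rewrite -sum1dep_card big_mkcondr.
have ltWS : (#|W :\ inl i0.1| < #|S|)%N.
  by move: leWS; rewrite (cardsD1 (inl i0.1) W) Wi0.
have [c [[i Si ci] cW]] := exists_linear_relation (@edge_pt R E V) ltWS.
have cz z : z != inl i0.1 -> \sum_(i in S) c i * edge_pt R i z = 0.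
  move=> nz; have [Wz|nWz] := boolP (z \in W); first by rewrite cW // in_setD1 nz.
  apply: big1 => j Sj; have [->|jz] := eqVneq (edge_pt R j z) 0; first by rewrite mulr0.
  by case/negP: nWz; rewrite inE; apply/set0Pn; exists j; rewrite inE Sj.
have c0 : \sum_(i in S) c i = 0.
  by rewrite -sum_edge_pt_inr; apply: big1 => v _; apply: cz.
have := indS c c0 _ i Si; move/eqP: ci => ci /(_ _)/ci[] z.
have [->|/cz //] := eqVneq z (inl i0.1).
rewrite -[RHS]c0 -[RHS]sum_edge_pt_inl (bigD1 i0.1) //= [X in _ + X]big1 ?addr0 //.
by move=> e ne; apply: cz.
Qed.

(** The edges with non-integer coefficient would form a nonempty independent set, which has a leaf.
    At the leaf vertex all other terms are integers, so the leaf coefficient is an integer too, a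
    contradiction. *)
Lemma aff_indep_coord_int S c : aff_indep R S ->
  (forall z, \sum_(i in S) c i * edge_pt R i z \is a Num.int) ->
  {in S, forall i, c i \is a Num.int}.
Proof.
move=> indS cint i Si; apply: contraT => nci.
pose S' := [set i in S | c i \isn't a Num.int].
have sS'S : S' \subset S by apply/subsetP=> j; rewrite inE => /andP[].
have S'0 : S' != set0 by apply/set0Pn; exists i; rewrite inE Si.
have [z [j [/setIdP[Sj ncj] jz jleaf]]] := aff_indep_leaf (aff_indep_sub sS'S indS) S'0.
have pt_int k : edge_pt R k z \is a Num.int by rewrite rpred_nat.
case/negP: ncj; have -> : c j = c j * edge_pt R j z.
  by move: jz; rewrite /edge_pt; case: (_ || _); rewrite ?mulr1 ?eqxx.
have := cint z; rewrite (bigD1 j) //= rpredDr // rpred_sum // => k /andP[Sk nkj].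
have [ck|nck] := boolP (c k \is a Num.int); first exact: rpredM.
by rewrite jleaf ?mulr0 ?rpred0 // inE Sk.
Qed.

Lemma edge_pt_in_conv S i : i \in S -> in_conv S (edge_pt R i).
Proof.
move=> Si; exists (fun j => (j == i)%:R); split=> [j|j nSj||z].
- exact: ler0n.
- by case: eqP nSj => // ->; rewrite Si.
- by rewrite (bigD1 i) //= eqxx big1 ?addr0 // => j /andP[_ /negPf->].
- rewrite (bigD1 i) //= eqxx mul1r big1 ?addr0 // => j /andP[_ /negPf->].
  by rewrite mul0r.
Qed.

End EdgeVectors.

(** * Lattice points of the dilates as multiplicities on faces *)

Section LatticePoints.
Variables (R : realType) (E V : finType) (N : nat).
Implicit Types (S F G : {set E * V}) (T : {set {set E * V}})
  (m : {ffun E * V -> 'I_N.+1}).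

(** The empty face belongs to this set as soon as [T] is nonempty. *)
Definition faces T : {set {set E * V}} :=
  [set F : {set E * V} | [exists S in T, F \subset S]].

(** Multiplicities are bounded by [N] so that the maps [m] form a finite type; this excludes no map
    of total size at most [N]. *)
Definition mult_supp m : {set E * V} := [set i | m i != 0 :> nat].

Definition mult_size m : nat := (\sum_i m i)%N.

Definition mult_pt m : {ffun E + V -> int} :=
  [ffun z => \sum_i (((z == inl i.1) || (z == inr i.2)) * m i)%N%:R].

Lemma mult_supp0 m i : i \notin mult_supp m -> m i = 0 :> nat.
Proof. by rewrite inE negbK => /eqP. Qed.

Lemma mult_ptE m S z : mult_supp m \subset S ->
  (mult_pt m z)%:~R = \sum_(i in S) (m i)%:R * edge_pt R i z.
Proof.
move=> mS; rewrite ffunE rmorph_sum [RHS]big_mkcond; apply: eq_bigr => i _ /=.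
rewrite rmorph_nat natrM mulrC; case: ifPn => // nSi.
by rewrite mult_supp0 ?mul0r //; apply: contra nSi; apply: (subsetP mS).
Qed.

Lemma mult_sizeE m S : mult_supp m \subset S ->
  mult_size m = (\sum_(i in S) m i)%N.
Proof.
move=> mS; rewrite /mult_size [RHS]big_mkcond; apply: eq_bigr => i _.
by case: ifPn => // nSi; apply: mult_supp0; apply: contra nSi; apply: (subsetP mS).
Qed.

Lemma mult_size_eq0 m i : mult_size m = 0%N -> m i = 0 :> nat.
Proof. by move/eqP; rewrite sum_nat_eq0 => /forall_inP/(_ i isT)/eqP. Qed.

Lemma in_convS S S' x : S \subset S' -> in_conv (R := R) S x -> in_conv S' x.
Proof.
move=> sSS' [lam [lam_ge0 lam0 lam1 xlam]]; exists lam.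
have widen g : \sum_(i in S) lam i * g i = \sum_(i in S') lam i * g i.
  rewrite [RHS](big_setID S) /= (setIidPr sSS') [X in _ + X]big1 ?addr0 // => i.
  by case/setDP=> _ /lam0 ->; rewrite mul0r.
split=> // [i nS'i||z]; last by rewrite xlam widen.
  by apply: lam0; apply: contra nS'i; apply: (subsetP sSS').
have := widen (fun=> 1); under eq_bigr do rewrite mulr1.
  by under [RHS]eq_bigr do rewrite mulr1; rewrite lam1.
Qed.

Lemma mult_pt_in_conv m S s : mult_supp m \subset S -> mult_size m = s.+1 ->
  in_conv S (fun z => (mult_pt m z)%:~R / s.+1%:R : R).
Proof.
move=> mS ms; exists (fun i => (m i)%:R / s.+1%:R); split.
- by move=> i; rewrite divr_ge0 ?ler0n.
- by move=> i nSi; rewrite mult_supp0 ?mul0r //; apply: contra nSi; apply: (subsetP mS).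
- by rewrite -mulr_suml -natr_sum -(mult_sizeE mS) ms divff // pnatr_eq0.
- move=> z; rewrite (mult_ptE _ mS) mulr_suml.
  by apply: eq_bigr => i _; rewrite mulrAC.
Qed.

Section Triangulated.
Variables (G : {set E * V}) (T : {set {set E * V}}).
Hypothesis triT : triangulation R G T.

(** Divided by the common size, the point lies in two simplices, hence in the hull of a common face
    [F]. Its weights [lam] on [F], extended by zero, must be its coordinates in each simplex, so
    they determine both maps. *)
Lemma mult_pt_inj m1 m2 : mult_supp m1 \in faces T -> mult_supp m2 \in faces T ->
  mult_size m1 = mult_size m2 -> mult_pt m1 = mult_pt m2 -> m1 = m2.
Proof.
have [simplexT faceT _] := triT.
rewrite !inE => /exists_inP[S1 TS1 m1S1] /exists_inP[S2 TS2 m2S2] eqs eqpt.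
apply/ffunP=> i; apply/val_inj => /=.
(* Size 0 is treated apart, since the point cannot be rescaled into the polytope. *)
case ms1: (mult_size m1) => [|s]; first by rewrite !mult_size_eq0 // -eqs.
have ms2 : mult_size m2 = s.+1 by rewrite -eqs.
have [F /andP[FS1 FS2] eqF] := faceT _ _ TS1 TS2.
have x1 := mult_pt_in_conv m1S1 ms1; have x2 := mult_pt_in_conv m2S2 ms2.
rewrite -eqpt in x2; have [lam [_ lam0 _ xlam]] := (eqF _).1 (conj x1 x2).
have coordE m S : S \in T -> F \subset S -> mult_supp m \subset S ->
    mult_size m = s.+1 -> mult_pt m = mult_pt m1 -> (m i)%:R = s.+1%:R * lam i.
  move=> TS FS mS ms ptm; have [Si|nSi] := boolP (i \in S); last first.
    rewrite mult_supp0 ?lam0 ?mulr0 //; first by apply: contra nSi; apply: (subsetP FS).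
    by apply: contra nSi; apply: (subsetP mS).
  have [_ _ indS] := simplexT _ TS.
  have s_neq0 : s.+1%:R != 0 :> R by rewrite pnatr_eq0.
  apply: (aff_indep_coord_inj (c := fun i => (m i)%:R)
            (c' := fun i => s.+1%:R * lam i) indS) => // z.
  rewrite -(mult_ptE _ mS) ptm -[LHS](divfK s_neq0) xlam mulrC mulr_sumr.
  rewrite [RHS](big_setID F) /= (setIidPr FS) [X in _ + X]big1 ?addr0.
    by apply: eq_bigr => j _; rewrite mulrA.
  by move=> j /setDP[_ /lam0 ->]; rewrite mulr0 mul0r.
apply/eqP; rewrite -(eqr_nat R); apply/eqP.
by rewrite (coordE m1 S1) // (coordE m2 S2).
Qed.

(* For s = 0, the dilate is {0} only because [G] is nonempty. *)
Lemma mult_pt_dilate m s : G != set0 -> mult_supp m \in faces T -> mult_size m = s ->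
  dilate s (root_polytope (R := R) G) (fun z => (mult_pt m z)%:~R).
Proof.
have [simplexT _ _] := triT.
move=> /set0Pn[i0 Gi0]; rewrite inE => /exists_inP[S TS mS].
case: s => [ms|s ms].
  exists (edge_pt R i0); split; first exact: edge_pt_in_conv.
  move=> z; rewrite (mult_ptE _ mS) mul0r; apply: big1 => i _.
  by rewrite mult_size_eq0 ?mul0r.
exists (fun z => (mult_pt m z)%:~R / s.+1%:R); split; last first.
  by move=> z; rewrite mulrC divfK // pnatr_eq0.
have [SG _ _] := simplexT _ TS.
exact: in_convS SG (mult_pt_in_conv mS ms).
Qed.

(** The barycentric coordinates in a simplex that contains [y], multiplied by [s], are integers by
    unimodularity and nonnegative. They sum to [s], so each is at most [N]. *)
Lemma dilate_mult_pt s (x : {ffun E + V -> int}) : (s <= N)%N ->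
  dilate s (root_polytope (R := R) G) (fun z => (x z)%:~R) ->
  exists m, [/\ mult_supp m \in faces T, mult_size m = s & x = mult_pt m].
Proof.
have [simplexT _ coverT] := triT.
move=> leN [y [Qy xy]]; have [S TS [lam [lam_ge0 lam0 lam1 ylam]]] := coverT _ Qy.
have [_ _ indS] := simplexT _ TS.
have xE z : (x z)%:~R = \sum_(i in S) s%:R * lam i * edge_pt R i z.
  by rewrite xy ylam mulr_sumr; under eq_bigr do rewrite mulrA.
have lam_int : {in S, forall i, s%:R * lam i \is a Num.int}.
  by apply: (aff_indep_coord_int indS) => z; rewrite -xE rpred_int.
have lam_nat i : s%:R * lam i \is a Num.nat.
  rewrite natrEint mulr_ge0 // ?ler0n // andbT.
  by have [/lam_int //|/lam0->] := boolP (i \in S); rewrite mulr0 rpred0.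
pose k i := Num.truncn (s%:R * lam i).
have kE i : (k i)%:R = s%:R * lam i by rewrite truncnK.
have sum_k : (\sum_(i in S) k i)%N = s.
  apply/eqP; rewrite -(eqr_nat R) natr_sum.
  by under eq_bigr do rewrite kE; rewrite -mulr_sumr lam1 mulr1.
have k0 i : i \notin S -> k i = 0%N.
  by move=> /lam0 l0; apply/eqP; rewrite -(eqr_nat R) kE l0 mulr0.
have kN i : (k i < N.+1)%N.
  rewrite ltnS; apply: leq_trans leN.
  have [Si|/k0->//] := boolP (i \in S).
  by rewrite -sum_k (bigD1 i) //= leq_addr.
pose m := [ffun i => Ordinal (kN i)].
have mS : mult_supp m \subset S.
  by apply/subsetP=> i; rewrite inE ffunE /=; apply: contraR => /k0->.
exists m; split.
- by rewrite inE; apply/exists_inP; exists S.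
- by rewrite (mult_sizeE mS) -[RHS]sum_k; apply: eq_bigr => i _; rewrite ffunE.
apply/ffunP=> z; apply/eqP; rewrite -(eqr_int R) xE (mult_ptE _ mS); apply/eqP.
by apply: eq_bigr => i _; rewrite ffunE kE.
Qed.

Definition face_mults s := [set m | (mult_supp m \in faces T) && (mult_size m == s)].

Lemma lattice_count_face_mults s : G != set0 -> (s <= N)%N ->
  lattice_count R G s #|face_mults s|.
Proof.
move=> G0 leN; exists [seq mult_pt m | m <- enum (face_mults s)]; split.
- rewrite map_inj_in_uniq ?enum_uniq // => m1 m2; rewrite !mem_enum.
  by move=> /setIdP[F1 /eqP s1] /setIdP[F2 /eqP s2]; apply: mult_pt_inj; rewrite ?s1.
- move=> x; split=> [/mapP[m]|/(dilate_mult_pt leN)[m [Fm sm ->]]].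
    rewrite mem_enum => /setIdP[Fm /eqP sm] ->.
    exact: mult_pt_dilate.
  by apply/map_f; rewrite mem_enum inE Fm sm eqxx.
- by rewrite size_map -cardE.
Qed.

End Triangulated.

End LatticePoints.

Lemma lattice_count_inj (R : realType) (E V : finType) (G : {set E * V}) s n1 n2 :
  lattice_count R G s n1 -> lattice_count R G s n2 -> n1 = n2.
Proof.
move=> [l1 [uniq1 l1P <-]] [l2 [uniq2 l2P <-]].
apply/perm_size/uniq_perm => // x.
by apply/idP/idP => [/l1P/l2P|/l2P/l1P].
Qed.

(** * Power series modulo a power of ['X], and reversed polynomials *)

Section TruncatedSeries.
Variable K : fieldType.
Implicit Types (p q : {poly K}) (n d k : nat).

Lemma dvdXnP n p : reflect (forall i, (i < n)%N -> p`_i = 0) ('X^n %| p).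
Proof.
apply: (iffP idP) => [/dvdpP[q ->] i lt_in|p0]; first by rewrite coefMXn lt_in.
rewrite -(poly_take_drop n p) [take_poly n p](_ : _ = 0) ?add0r ?dvdp_mulIr //.
by apply/polyP=> i; rewrite coef_take_poly coef0; case: ifP => // /p0.
Qed.

Lemma dvdXn_eq0 n p : (size p <= n)%N -> 'X^n %| p -> p = 0.
Proof.
move=> szp /dvdXnP p0; apply/polyP=> i; rewrite coef0.
by have [/p0//|le_ni] := ltnP i n; rewrite nth_default // (leq_trans szp).
Qed.

(** This is the expansion of t^k / (1 - t)^(d+1). The factor [(k <= s)%N] removes the terms with s <
    k, where truncated subtraction would give the value 1. *)
Lemma binomial_series n d k :
  ('X^n : {poly K}) %| (1 - 'X) ^+ d.+1 *
    (\poly_(s < n) ((k <= s)%N * 'C(s - k + d, d))%:R) - 'X^k.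
Proof.
elim: d => [|d IHd].
  apply/dvdXnP => i lt_in.
  rewrite expr1 mulrBl mul1r !coefB coefXM coefXn !coef_poly lt_in bin0 muln1.
  have -> : (i.-1 < n)%N by apply: leq_ltn_trans lt_in; apply: leq_pred.
  case: i lt_in => [|i] _; first by rewrite leqn0 eq_sym subr0 subrr.
  rewrite bin0 muln1 -pred_Sn (leq_eqVlt k i.+1) ltnS eq_sym.
  have [<-|_] := eqVneq i.+1 k; first by rewrite ltnn subr0 subrr.
  by rewrite /= subrr subrr.
rewrite exprSr -mulrA.
(* Multiplication by [1 - 'X] takes successive differences, which by Pascal's rule turn the series
   [P] for [d.+1] into the series [Q] for [d]. *)
set P := \poly_(s < n) _; set Q := \poly_(s < n) _ in IHd.
have -> : (1 - 'X) ^+ d.+1 * ((1 - 'X) * P) - 'X^k =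
    (1 - 'X) ^+ d.+1 * ((1 - 'X) * P - Q) + ((1 - 'X) ^+ d.+1 * Q - 'X^k).
  by rewrite mulrBr addrA subrK.
rewrite dvdp_addl // dvdp_mull //.
apply/dvdXnP => i lt_in.
rewrite mulrBl mul1r !coefB coefXM !coef_poly lt_in.
have -> : (i.-1 < n)%N by apply: leq_ltn_trans lt_in; apply: leq_pred.
case: i lt_in => [|i] _.
  by rewrite sub0n !binn subr0 subrr.
rewrite -pred_Sn (leq_eqVlt k i.+1) ltnS eq_sym.
have [<-|_] := eqVneq i.+1 k; first by rewrite ltnn subnn !binn subr0 subrr.
have [le_ki|_] := leqP k i; last by rewrite /= !mul0n !subr0.
by rewrite /= !mul1n subSn // addSn binS -addSnnS natrD addrAC addrK subrr.
Qed.

(** By the geometric sum, the product equals t^k (1 - t^n)^k, and (1 - t^n)^k - 1 is divisible by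
    t^n. *)
Lemma geometric_series_expn n k :
  ('X^(n.+1) : {poly K}) %| (1 - 'X) ^+ k * (\sum_(j < n) 'X^(j.+1)) ^+ k - 'X^k.
Proof.
have -> : \sum_(j < n) 'X^(j.+1) = 'X * \sum_(j < n) 'X^j :> {poly K}.
  by rewrite mulr_sumr; apply: eq_bigr => j _; rewrite exprS.
rewrite -exprMn mulrCA -[1 - 'X]opprB mulNr -subrX1 opprB exprMn.
rewrite -{2}['X^k]mulr1 -mulrBr.
(* For positive exponent, ['X^k] supplies the one further factor ['X] needed to reach ['X^(n.+1)];
   for exponent 0 the difference is 0. *)
case: k => [|k]; first by rewrite !expr0 subrr mulr0 dvdp0.
rewrite subrX1 !exprS [1 - _ - 1]addrAC subrr add0r -mulrA dvdp_mul //.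
by rewrite mulrA dvdp_mulr // mulrN dvdpNr dvdp_mulIr.
Qed.

(** For p of degree at most n this is x^n p(1/x); coefficients beyond degree n are discarded. *)
Definition rev_poly n p : {poly K} := \sum_(i < n.+1) p`_i *: 'X^(n - i).

Lemma coef_rev_poly n p i : (i <= n)%N -> (rev_poly n p)`_i = p`_(n - i).
Proof.
move=> le_in; rewrite coef_sum (bigD1 (inord (n - i))) //= coefZ coefXn.
rewrite inordK ?ltnS ?leq_subr // subKn // eqxx mulr1 big1 ?addr0 // => j.
rewrite -val_eqE /= inordK ?ltnS ?leq_subr // => ne_j.
rewrite coefZ coefXn; case: eqP => [i_nj|]; last by rewrite mulr0.
by rewrite i_nj subKn ?eqxx // -ltnS in ne_j.
Qed.

Lemma size_rev_poly n p : (size (rev_poly n p) <= n.+1)%N.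
Proof.
apply: leq_trans (size_sum _ _ _) _; apply/bigmax_leqP => i _.
by apply: leq_trans (size_scale_leq _ _) _; rewrite size_polyXn ltnS leq_subr.
Qed.

Lemma rev_poly_inj n p q : (size p <= n.+1)%N -> (size q <= n.+1)%N ->
  rev_poly n p = rev_poly n q -> p = q.
Proof.
move=> szp szq eq_rev; apply/polyP=> i.
have [lt_ni|le_in] := ltnP n i.
  by rewrite !nth_default // ?(leq_trans szp) ?(leq_trans szq).
by rewrite -(subKn le_in) -!coef_rev_poly ?eq_rev ?leq_subr.
Qed.

Lemma rev_poly_sum (I : finType) (P : pred I) n (F : I -> {poly K}) :
  rev_poly n (\sum_(i | P i) F i) = \sum_(i | P i) rev_poly n (F i).
Proof.
rewrite exchange_big /=; apply: eq_bigr => i _.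
by rewrite coef_sum scaler_suml.
Qed.

(** Formally x^n (1/x - 1)^(n-k); the proof reverses the binomial expansion term by term. *)
Lemma rev_poly_Xsub1_expn n k : (k <= n)%N ->
  rev_poly n (('X - 1) ^+ (n - k)) = 'X^k * (1 - 'X) ^+ (n - k).
Proof.
move=> le_kn; set m := (n - k)%N.
have rev_monom (c : K) j : (j <= n)%N -> rev_poly n (c *: 'X^j) = c *: 'X^(n - j).
  move=> le_jn; apply/polyP=> i; have [lt_ni|le_in] := ltnP n i.
    rewrite nth_default ?(leq_trans (size_rev_poly _ _)) // coefZ coefXn.
    by rewrite gtn_eqF ?mulr0 // (leq_ltn_trans (leq_subr _ _)).
  rewrite coef_rev_poly // !coefZ !coefXn; congr (_ * (_ : bool)%:R).
  by apply/eqP/eqP => [<-|->]; rewrite subKn.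
rewrite !exprBn rev_poly_sum mulr_sumr; apply: eq_bigr => i _.
have le_im : (i <= m)%N by rewrite -ltnS.
have -> : (-1) ^+ i = ((-1) ^+ i)%:P :> {poly K} by rewrite polyC_exp polyCN.
rewrite !expr1n !mulr1 !mul_polyC -!scaler_nat !scalerA rev_monom; last first.
  by rewrite (leq_trans (leq_subr _ _)) ?leq_subr.
rewrite -scalerAr -exprD; congr (_ *: 'X^_).
by rewrite subnBA // -addnBAC ?leq_subr // subKn.
Qed.

End TruncatedSeries.

(** * The generating function of the multiplicities and the h-polynomial *)

Section GeneratingFunction.
Variables (E V : finType) (T : {set {set E * V}}) (N : nat).
Local Notation D := (rp_dim E V).+1.
Implicit Types (F : {set E * V}) (m : {ffun E * V -> 'I_N.+1}).

(** If [T] triangulates the root polytope of a nonempty [G], this agrees with the Ehrhart series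
    modulo ['X^(N.+1)]; in higher degrees the bound on multiplicities may lose terms. *)
Definition mult_series : {poly rat} :=
  \sum_(m : {ffun E * V -> 'I_N.+1} | mult_supp m \in faces T) 'X^(mult_size m).

Lemma coef_mult_series s : mult_series`_s = #|face_mults N T s|%:R.
Proof.
rewrite coef_sum -sum1dep_card natr_sum big_mkcondr /=.
by apply: eq_bigr => m _; rewrite coefXn eq_sym; case: eqP.
Qed.

(** The values of [m] are chosen independently: from 1 to [N] on [F], and 0 elsewhere.
    Distributivity turns the sum into a product over the edges. *)
Lemma sum_mult_supp_eq F :
  \sum_(m : {ffun E * V -> 'I_N.+1} | mult_supp m == F) 'X^(mult_size m)
  = (\sum_(j < N) 'X^(j.+1)) ^+ #|F| :> {poly rat}.
Proof.
pose Q (i : E * V) := [pred j : 'I_N.+1 | (j != 0 :> nat) == (i \in F)].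
transitivity (\sum_(m in family Q) \prod_i 'X^(m i) : {poly rat}).
  apply: eq_big => [m|m _]; last first.
    by apply: (big_morph (fun n => 'X^n)) => // a b; rewrite exprD.
  apply/eqP/familyP => [eqF i|mF]; first by rewrite !inE -eqF inE.
  by apply/setP=> i; have := mF i; rewrite !inE => /eqP.
rewrite -(bigA_distr_big_dep Q (fun _ (j : 'I_N.+1) => 'X^j)) /=.
rewrite -prodr_const [RHS]big_mkcond; apply: eq_bigr => i _ /=.
rewrite big_mkcond big_ord_recl /=; case: (i \in F) => /=.
  by rewrite add0r; apply: eq_bigr.
by rewrite big1 ?addr0.
Qed.

Lemma mult_series_faces :
  mult_series = \sum_(F in faces T) (\sum_(j < N) 'X^(j.+1)) ^+ #|F|.
Proof.
rewrite /mult_series (partition_big (@mult_supp E V N) (mem (faces T))) //=.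
apply: eq_bigr => F TF; rewrite -sum_mult_supp_eq.
by apply: eq_bigl => m; case: eqP => [->|]; rewrite ?TF ?andbF.
Qed.

Hypotheses (T0 : T != set0) (cardT : {in T, forall S : {set E * V}, #|S| = D}).

Lemma card_face F : F \in faces T -> (#|F| <= D)%N.
Proof. by rewrite inE => /exists_inP[S TS /subset_leq_card]; rewrite (cardT TS). Qed.

(** Faces are grouped by cardinality, a k-dimensional simplex having k+1 vertices. The leading
    monomial is the contribution of the empty face, present because [T] is nonempty. *)
Lemma fpoly_faces : fpoly T = \sum_(F in faces T) 'X^(D - #|F|).
Proof.
rewrite (partition_big (fun F => inord #|F| : 'I_D.+1) xpredT) //=.
rewrite big_ord_recl /=; congr (_ + _).
  rewrite (bigD1 set0) ?cards0 /=; last first.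
    rewrite inE; case/set0Pn: T0 => S TS; apply/andP; split.
      by apply/exists_inP; exists S; rewrite ?sub0set.
    by apply/eqP/val_inj; rewrite /= inordK.
  rewrite big1 ?addr0 // => F /andP[/andP[TF /eqP/(congr1 val)/=]].
  rewrite inordK ?ltnS ?card_face // => /eqP.
  by rewrite cards_eq0 => /eqP->; rewrite eqxx.
apply: eq_bigr => k _; rewrite scaler_nat -sumr_const.
apply: eq_big => [F|F]; rewrite !inE.
  rewrite andbC; case TF: [exists S in T, F \subset S] => //=.
  rewrite -val_eqE /= inordK ?ltnS ?card_face ?inE //.
by case/andP=> /eqP-> _; rewrite subSS.
Qed.

Lemma hpoly_faces : hpoly T = \sum_(F in faces T) ('X - 1) ^+ (D - #|F|).
Proof.
rewrite /hpoly fpoly_faces rmorph_sum /=.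
by apply: eq_bigr => F _; rewrite comp_Xn_poly.
Qed.

Lemma size_hpoly : (size (hpoly T) <= D.+1)%N.
Proof.
rewrite /hpoly size_comp_poly2; last by rewrite -polyC1 size_XsubC.
rewrite fpoly_faces (leq_trans (size_sum _ _ _)) //; apply/bigmax_leqP => F _.
by rewrite size_polyXn ltnS leq_subr.
Qed.

(** The congruence holds face by face: (1 - t)^D (t / (1 - t))^|F| = t^|F| (1 - t)^(D - |F|), which
    is the reversal of the term of [F] in [hpoly_faces]. *)
Lemma dvd_mult_series_hpoly :
  'X^(N.+1) %| (1 - 'X) ^+ D * mult_series - rev_poly D (hpoly T).
Proof.
rewrite hpoly_faces rev_poly_sum mult_series_faces mulr_sumr -sumrB.
apply: (big_ind (fun p => 'X^(N.+1) %| p)) => [|p q dp dq|F TF]; first exact: dvdp0.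
  exact: dvdp_add.
have FD := card_face TF; rewrite rev_poly_Xsub1_expn // mulrC.
rewrite -{1}(subnK FD) exprD mulrCA ['X^_ * _]mulrC -mulrBr dvdp_mull //.
by rewrite mulrC geometric_series_expn.
Qed.

End GeneratingFunction.

(** * Comparison of the Ehrhart series with the h-vector *)

Lemma bip_connected_neq0 (E V : finType) (G : {set E * V}) :
  (0 < #|E|)%N -> (0 < #|V|)%N -> bip_connected G -> G != set0.
Proof.
move=> /card_gt0P[e _] /card_gt0P[v _] /(_ (inl e) (inr v)) /connectP[[//|[//|w] p]] /=.
by case/andP=> Gew _ _; apply/set0Pn; exists (e, w).
Qed.

Lemma triangulation_neq0 (R : realType) (E V : finType) (G : {set E * V}) T :
  G != set0 -> triangulation R G T -> T != set0.
Proof.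
move=> /set0Pn[i Gi] [_ _ cover]; have [|S TS _] := cover (edge_pt R i).
  exact: edge_pt_in_conv.
by apply/set0Pn; exists S.
Qed.

Theorem theorem3p9 (R : realType) (E V : finType) (G : {set E * V}) :
  (0 < #|E|)%N -> (0 < #|V|)%N -> bip_connected G ->
  (forall a : 'I_(rp_dim E V).+1 -> rat,
     (forall s : nat, exists2 n : nat, lattice_count R G s n &
        n%:R = \sum_(k < (rp_dim E V).+1) a k * ('C(s + rp_dim E V - k, rp_dim E V))%:R) ->
     forall T : {set {set E * V}}, triangulation R G T ->
       \sum_(i < (rp_dim E V).+2) (hpoly T)`_i *: 'X^((rp_dim E V).+1 - i)
       = \sum_(k < (rp_dim E V).+1) a k *: 'X^k)
  /\
  (forall T1 T2 : {set {set E * V}},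
     triangulation R G T1 -> triangulation R G T2 -> hpoly T1 = hpoly T2).
Proof.
move=> E0 V0 conG; have G0 := bip_connected_neq0 E0 V0 conG.
(* The polynomials to be compared have degree at most [d.+1], so with this [N] congruence modulo
   ['X^(N.+1)] amounts to equality. *)
set d := rp_dim E V; pose N := d.+1.
have cardT T : triangulation R G T -> {in T, forall S : {set E * V}, #|S| = d.+1}.
  by case=> simplexT _ _ S /simplexT[].
have countT T s : triangulation R G T -> (s <= N)%N ->
    lattice_count R G s #|face_mults N T s|.
  by move=> triT leN; apply: lattice_count_face_mults.
have seriesT T : triangulation R G T ->
    'X^(N.+1) %| (1 - 'X) ^+ d.+1 * mult_series T N - rev_poly d.+1 (hpoly T).
  move=> triT; apply: dvd_mult_series_hpoly (cardT T triT).
  exact: triangulation_neq0 triT.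
split=> [a aE T triT|T1 T2 tri1 tri2]; last first.
  (* Both series have the lattice counts of [G] as coefficients up to degree [N], and these do not
     depend on the triangulation. *)
  have eq_series : 'X^(N.+1) %| mult_series T1 N - mult_series T2 N.
    apply/dvdXnP => s ltsN; rewrite coefB !coef_mult_series.
    have leN : (s <= N)%N by rewrite -ltnS.
    by rewrite (lattice_count_inj (countT _ _ tri1 leN) (countT _ _ tri2 leN)) subrr.
  apply: (@rev_poly_inj _ d.+1).
  - apply: size_hpoly (cardT _ tri1); exact: triangulation_neq0 tri1.
  - apply: size_hpoly (cardT _ tri2); exact: triangulation_neq0 tri2.
  apply/eqP; rewrite -subr_eq0; apply/eqP; apply: (@dvdXn_eq0 _ N.+1).
    rewrite (leq_trans (size_polyD _ _)) // size_polyN geq_max.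
    by rewrite !size_rev_poly.
  have -> : rev_poly d.+1 (hpoly T1) - rev_poly d.+1 (hpoly T2) =
      (1 - 'X) ^+ d.+1 * (mult_series T1 N - mult_series T2 N)
      - ((1 - 'X) ^+ d.+1 * mult_series T1 N - rev_poly d.+1 (hpoly T1))
      + ((1 - 'X) ^+ d.+1 * mult_series T2 N - rev_poly d.+1 (hpoly T2)) by ring.
  by apply: dvdp_add (seriesT _ tri2); apply: dvdp_sub (seriesT _ tri1); apply: dvdp_mull.
apply/eqP; rewrite -subr_eq0; apply/eqP; apply: (@dvdXn_eq0 _ N.+1).
  rewrite (leq_trans (size_polyD _ _)) // size_polyN geq_max.
  rewrite (size_rev_poly d.+1 (hpoly T)) /=.
  apply: leq_trans (size_sum _ _ _) _; apply/bigmax_leqP => k _.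
  by rewrite (leq_trans (size_scale_leq _ _)) // size_polyXn ltnS ltnW.
pose Q k : {poly rat} := \poly_(s < N.+1) ((k <= s)%N * 'C(s - k + d, d))%:R.
have eq_series : 'X^(N.+1) %| mult_series T N - \sum_(k < d.+1) a k *: Q k.
  apply/dvdXnP => s ltsN; rewrite coefB coef_mult_series coef_sum.
  have [n cn nE] := aE s.
  rewrite (lattice_count_inj (countT _ _ triT ltsN) cn) nE.
  rewrite -sumrB big1 // => k _; rewrite coefZ coef_poly ltsN -mulrBr.
  case: (leqP k s) => [le_ks|lt_sk]; first by rewrite mul1n addnBAC // subrr mulr0.
  (* Since k <= d, the subtraction in [s + d - k] is exact, and s < k makes the result smaller than
     d: the binomial vanishes, as does the term of [Q k]. *)
  rewrite bin_small ?mul0n ?subrr ?mulr0 // ltn_subLR ?ltn_add2r //.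
  by rewrite (leq_trans _ (leq_addl _ _)) // -ltnS.
have eq_binom : 'X^(N.+1) %| (1 - 'X) ^+ d.+1 * (\sum_(k < d.+1) a k *: Q k)
                  - \sum_(k < d.+1) a k *: 'X^k.
  rewrite mulr_sumr -sumrB.
  apply: (big_ind (fun p => 'X^(N.+1) %| p)) => [|p q|k _]; first exact: dvdp0.
    exact: dvdp_add.
  by rewrite -scalerAr -scalerBr -mul_polyC dvdp_mull // binomial_series.
rewrite -/(rev_poly d.+1 (hpoly T)).
(* The difference telescopes through the two series multiplied by [(1 - 'X) ^+ d.+1], leaving three
   multiples of ['X^(N.+1)]. *)
have -> : rev_poly d.+1 (hpoly T) - \sum_(k < d.+1) a k *: 'X^k =
    (1 - 'X) ^+ d.+1 * (mult_series T N - \sum_(k < d.+1) a k *: Q k)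
    - ((1 - 'X) ^+ d.+1 * mult_series T N - rev_poly d.+1 (hpoly T))
    + ((1 - 'X) ^+ d.+1 * (\sum_(k < d.+1) a k *: Q k)
       - \sum_(k < d.+1) a k *: 'X^k) by ring.
by apply: dvdp_add eq_binom; apply: dvdp_sub (seriesT _ triT); apply: dvdp_mull.
Qed.
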